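(* Let $\nu$ be a pm valuation on $K[\chi]$ and $d$ be a positive integer such that $1\le d\le[K(\chi):K]/2$. Then $d$ is a valuational key degree if, and only if, $\nu K_{d-1}[\chi]$ is a group and $\nu K_d[\chi]\ne\nu K_{d-1}[\chi]$. If this holds, then every monic polynomial $\Phi$ of degree $d$ such that $\nu(\Phi)$ is the maximum of $\nu(\chi^d-K_{d-1}[\chi])$ (which is equivalent to saying that $\nu(\Phi)\notin\nu K_{d-1}[\chi]$) is a key polynomial.
   Context: $K$ is a field, $\chi\notin K$ is algebraic or transcendental over $K$; $[K[\chi]:K]=[K(\chi):K]=\infty$ if $\chi$ is transcendental. When $\chi$ is algebraic, elements of $K[\chi]$ are written uniquely as polynomials in $\chi$ of degree $<[K[\chi]:K]$. $K_m[\chi]$ is the $K$-module of polynomials of degree at most $m$. A $K$-module valuation is a map $\nu$ to $\Gamma\cup\{\infty\}$, $\Gamma$ a linearly ordered abelian group, such that $\nu(y)=\infty\Leftrightarrow y=0$, $\nu(y_1+y_2)\ge\min(\nu(y_1),\nu(y_2))$ and $\nu(xy)=\nu(x)+\nu(y)$ for $x\in K$. It is a pm (partially multiplicative) valuation if $\nu(fg)=\nu(f)+\nu(g)$ for all $f,g\in K[\chi]$ with $\deg(f)+\deg(g)<[K[\chi]:K]$; if $\chi$ is transcendental one requires moreover that $\nu$ is a field valuation on $K(\chi)$. It is assumed that $\nu K$ has finite rank. For a set $S$, $\nu S=\{\nu(s):s\in S\}\setminus\{\infty\}$; $\nu(\chi^d-K_{d-1}[\chi])$ is the set of values of monic polynomials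 of degree $d$ ($\infty$ excluded). ''$\nu K_{d-1}[\chi]$ is a group'' means it is a subgroup of $\Gamma$. For $\Phi$ monic of degree $d$, $1\le d<[K[\chi]:K]$, and $f,g\in K_{d-1}[\chi]$, $q_\Phi(f,g)$ and $r_\Phi(f,g)$ are the quotient and remainder of the euclidean division of $fg$ by $\Phi$. $\Phi$ is a key polynomial for $\nu$ if $\nu(fg)=\nu(r_\Phi(f,g))<\nu(q_\Phi(f,g)\Phi)$ for all nonzero $f,g\in K_{d-1}[\chi]$ with $\deg(f)+\deg(g)<[K[\chi]:K]$. $d$ is a key degree if there exists a key polynomial of degree $d$. A key degree $d$ is independent if $\nu(\chi^d-K_{d-1}[\chi])$ has a maximal element, and it is valuational if this maximum exists and does not belong to $\nu K_{d-1}[\chi]$. *)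

(* Defs.v *)
From HB Require Import structures.
From mathcomp Require Import all_boot all_order all_algebra.
From mathcomp Require Import boolp classical_sets cardinality.
Set Implicit Arguments.
Unset Strict Implicit.
Unset Printing Implicit Defensive.
Import Order.TTheory GRing.Theory Num.Theory.
Local Open Scope classical_set_scope.
Local Open Scope ring_scope.

(* A porderZmodType has a group law and a partial order with no axiom relating
   the two. *)
Definition linearly_ordered_group (G : porderZmodType) : Prop :=
  total (<=%R : rel G) /\ (forall x y z : G, x <= y -> x + z <= y + z).

(* [option T] stands for T with an element infinity, written [None], added on
   top.  It is used for value groups and, with T = nat, for degrees. *)
Section WithInfinity.
Context {disp : Order.disp_t} {T : porderType disp}.

Definition le_inf (a b : option T) : bool :=
  match a, b with
  | _, None => true
  | None, Some _ => false
  | Some x, Some y => (x <= y)%O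
  end.

Definition lt_inf (a b : option T) : bool := (a != b) && le_inf a b.

Definition min_inf (a b : option T) : option T := if le_inf a b then a else b.

Definition is_max (A : set (option T)) (a : option T) : Prop :=
  A a /\ forall b, A b -> le_inf b a.

End WithInfinity.

Definition add_inf (G : zmodType) (a b : option G) : option G :=
  if a is Some x then if b is Some y then Some (x + y) else None else None.

Definition is_group (G : zmodType) (A : set (option G)) : Prop :=
  ~ A None /\ zmod_closed (mem (Some @^-1` A)).

Definition convex_subgroup (G : porderZmodType) (A : set G) (H : set G) : Prop :=
  [/\ H `<=` A, zmod_closed (mem H) &
      forall x y, H x -> A y -> 0 <= y -> y <= x -> H y].

Definition finite_rank (G : porderZmodType) (A : set (option G)) : Prop :=
  finite_set [set H : set G | convex_subgroup (Some @^-1` A) H].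

(* K is a subfield of L through iota, and chi is an element of L. *)
Section SimpleExtension.
Variables (K L : fieldType) (iota : {rmorphism K -> L}) (chi : L).

Definition evchi (p : {poly K}) : L := (map_poly iota p).[chi].

Definition baseK : set L := range iota.

Definition Kring : set L := range evchi.

Definition Kfield : set L :=
  [set evchi p / evchi q | p in setT & q in [set q | evchi q != 0]].

Definition Kpoly (m : nat) : set L := evchi @` [set p : {poly K} | (size p <= m.+1)%N].

Definition monic_of_degree (m : nat) (P : {poly K}) : Prop :=
  P \is monic /\ size P = m.+1.

Definition is_basis (S : set L) (n : nat) (e : 'I_n -> L) : Prop :=
  [/\ forall i, S (e i),
      forall c : 'I_n -> K,
        \sum_(i < n) iota (c i) * e i = 0 -> forall i, c i = 0 &
      forall y, S y -> exists c : 'I_n -> K, y = \sum_(i < n) iota (c i) * e i].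

(* The dimension over K of a K-subspace S of L, [None] if it is infinite. *)
Definition Kdim (S : set L) : option nat :=
  if pselect (exists n, exists e : 'I_n -> L, is_basis S e) is left ex
  then Some (projT1 (cid ex)) else None.

Section Valuation.
Variables (G : porderZmodType) (nu : L -> option G).

Definition valset (S : set L) : set (option G) := (nu @` S) `\ None.

Definition module_valuation : Prop :=
  [/\ forall y, Kring y -> (nu y = None <-> y = 0),
      forall y1 y2, Kring y1 -> Kring y2 ->
        le_inf (min_inf (nu y1) (nu y2)) (nu (y1 + y2)) &
      forall x y, baseK x -> Kring y -> nu (x * y) = add_inf (nu x) (nu y)].

Definition field_valuation : Prop :=
  [/\ forall y, Kfield y -> (nu y = None <-> y = 0),
      forall y1 y2, Kfield y1 -> Kfield y2 ->
        le_inf (min_inf (nu y1) (nu y2)) (nu (y1 + y2)) &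
      forall y1 y2, Kfield y1 -> Kfield y2 ->
        nu (y1 * y2) = add_inf (nu y1) (nu y2)].

(* nu is a function on all of L; only its values on K(chi), which is K[chi]
   when chi is algebraic, are constrained.  The degree of a nonzero polynomial
   f is (size f).-1. *)
Definition pm_valuation : Prop :=
  [/\ module_valuation,
      forall f g : {poly K},
        lt_inf (Some ((size f).-1 + (size g).-1)%N) (Kdim Kring) ->
        nu (evchi f * evchi g) = add_inf (nu (evchi f)) (nu (evchi g)) &
      ~ algebraicOver iota chi -> field_valuation].

Definition key_polynomial (d : nat) (Phi : {poly K}) : Prop :=
  [/\ monic_of_degree d Phi, (0 < d)%N, lt_inf (Some d) (Kdim Kring) &
      forall f g : {poly K}, f != 0 -> g != 0 ->
        (size f <= d)%N -> (size g <= d)%N ->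
        lt_inf (Some ((size f).-1 + (size g).-1)%N) (Kdim Kring) ->
        nu (evchi f * evchi g) = nu (evchi ((f * g) %% Phi)) /\
        lt_inf (nu (evchi ((f * g) %% Phi)))
               (nu (evchi ((f * g) %/ Phi) * evchi Phi))].

Definition key_degree (d : nat) : Prop := exists Phi, key_polynomial d Phi.

Definition monic_values (d : nat) : set (option G) :=
  valset [set chi ^+ d - y | y in Kpoly d.-1].

Definition valuational_key_degree (d : nat) : Prop :=
  key_degree d /\
  exists2 m, is_max (monic_values d) m & ~ valset (Kpoly d.-1) m.

End Valuation.
End SimpleExtension.

(* Main.v *)
(* A key polynomial Phi of degree d makes every nonzero f of degree less than d
   invertible modulo Phi; as values are preserved by reduction modulo Phi, this
   makes the values in degree less than d a group A.  Conversely, let A be a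
   group and let Phi be monic of degree d with value outside A.  In
   f g = q Phi + r the values of f g and r lie in A while that of q Phi does
   not, so the ultrametric inequality leaves only v(f g) = v(r) < v(q Phi).
   The bound 2 d <= [K(chi) : K] makes every product involved multiplicative. *)
Require Import Defs.
From HB Require Import structures.
From mathcomp Require Import all_boot all_order all_algebra.
From mathcomp Require Import boolp classical_sets cardinality.
From mathcomp Require Import zify.
Set Implicit Arguments.
Unset Strict Implicit.
Unset Printing Implicit Defensive.
Import Order.TTheory GRing.Theory Num.Theory.
Local Open Scope classical_set_scope.
Local Open Scope ring_scope.

HB.instance Definition _ (K L : fieldType) (iota : {rmorphism K -> L}) (chi : L) :=
  GRing.RMorphism.copy (evchi iota chi) (horner_eval chi \o map_poly iota).

(** * Linear algebra over K and the dimensions of K[chi] and K(chi) *)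

Section Dimension.
Context (K L : fieldType) (iota : {rmorphism K -> L}).

(** The coordinates of the [x i] form an n by m matrix with more rows than columns; a nonzero row of
    its left kernel is the relation. *)
Lemma is_basis_dependent (S : set L) m (e : 'I_m -> L) n (x : 'I_n -> L) :
  is_basis iota S e -> (forall i, S (x i)) -> (m < n)%N ->
  exists2 c : 'I_n -> K, \sum_(i < n) iota (c i) * x i = 0 &
    exists i, c i != 0.
Proof.
move=> [_ _ gen_e] Sx lt_mn.
have [C xE] := choice (fun i => gen_e _ (Sx i)).
pose M := \matrix_(i < n, j < m) C i j.
have ker_neq0 : kermx M != 0.
  by rewrite kermx_eq0 /row_free neq_ltn (leq_ltn_trans (rank_leq_col M)).
have /rV0Pn[i vi_neq0] : nz_row (kermx M) != 0 by rewrite nz_row_eq0.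
exists (fun i => nz_row (kermx M) 0 i); last by exists i.
have /sub_kermxP vM0 := nz_row_sub (kermx M).
under eq_bigr => k _ do rewrite xE mulr_sumr.
rewrite exchange_big big1 // => j _.
have := congr1 (fun N : 'rV_m => iota (N 0 j)) vM0.
rewrite !mxE rmorph0 rmorph_sum => sum0.
rewrite -[RHS](mul0r (e j)) -[in RHS]sum0 mulr_suml.
by apply: eq_bigr => k _; rewrite mxE rmorphM mulrA.
Qed.

(** Needed because [Kdim] returns the size of an arbitrarily chosen basis. *)
Lemma is_basis_size (S : set L) m (e : 'I_m -> L) n (e' : 'I_n -> L) :
  is_basis iota S e -> is_basis iota S e' -> m = n.
Proof.
have le_size p q (u : 'I_p -> L) (v : 'I_q -> L) :
    is_basis iota S u -> is_basis iota S v -> (p <= q)%N.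
  move=> [Su free_u _] Bv; case: leqP => // lt_qp.
  have [c /free_u c0 [i]] := is_basis_dependent Bv Su lt_qp.
  by rewrite c0 eqxx.
move=> Be Be'; apply/eqP.
by rewrite eqn_leq (le_size _ _ _ _ Be Be') (le_size _ _ _ _ Be' Be).
Qed.

Lemma Kdim_is_basis (S : set L) n (e : 'I_n -> L) :
  is_basis iota S e -> Kdim iota S = Some n.
Proof.
move=> Be; rewrite /Kdim; case: pselect => [ex|]; last by case; exists n, e.
by case: cid => m [e' Be'] /=; rewrite (is_basis_size Be' Be).
Qed.

Variable chi : L.
Local Notation ev := (evchi iota chi).

Lemma evchiC c : ev c%:P = iota c.
Proof. by rewrite /evchi map_polyC hornerC. Qed.

Lemma evchiXn n : ev 'X^n = chi ^+ n.
Proof. by rewrite /evchi map_polyXn hornerXn. Qed.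

Lemma evchi_poly n (E : nat -> K) :
  ev (\poly_(i < n) E i) = \sum_(i < n) iota (E i) * chi ^+ i.
Proof.
rewrite poly_def rmorph_sum; apply: eq_bigr => i _.
by rewrite -mul_polyC rmorphM /= evchiC evchiXn.
Qed.

(** * The algebraic case, with [mu] an annihilator of chi of least degree *)

Section MinimalPolynomial.
Variable mu : {poly K}.
Hypotheses (mu_neq0 : mu != 0) (ev_mu : ev mu = 0).
Hypothesis mu_min : forall f, f != 0 -> ev f = 0 -> (size mu <= size f)%N.

(** Minimality of [mu] makes the powers free; reduction modulo [mu] makes them generate. *)
Lemma is_basis_powers :
  is_basis iota (Kring iota chi) (fun i : 'I_(size mu).-1 => chi ^+ i).
Proof.
have mu_gt0 : (0 < size mu)%N by rewrite size_poly_gt0.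
split=> [i|c c0 i|_ [f _ <-]].
- by exists 'X^i; rewrite ?evchiXn.
(* [\poly] takes coefficients indexed by nat, so [c] is extended by 0. *)
- pose E k := if insub k is Some j then c j else 0.
  have cE j : c j = E j by rewrite /E valK.
  have [p0|p_neq0] := eqVneq (\poly_(i < (size mu).-1) E i) 0.
    by have := congr1 (coefp i) p0; rewrite /= coef_poly coef0 ltn_ord -cE.
  have evp0 : ev (\poly_(i < (size mu).-1) E i) = 0.
    by rewrite evchi_poly -[RHS]c0; apply: eq_bigr => j _; rewrite cE.
  have := leq_trans (mu_min p_neq0 evp0) (size_poly _ _).
  by rewrite -ltnS prednK // ltnn.
- exists (fun i => (f %% mu)`_i).
  have -> : ev f = ev (f %% mu).
    by rewrite {1}(divp_eq f mu) rmorphD rmorphM /= ev_mu mulr0 add0r.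
  rewrite -(evchi_poly _ (nth 0 (f %% mu))); congr (evchi _ _ _).
  apply/polyP => i; rewrite coef_poly; case: ltnP => // le_i; rewrite nth_default //.
  by rewrite (leq_trans _ le_i) // -ltnS prednK // ltn_modp.
Qed.

(** A denominator not vanishing at chi is coprime to [mu], and Bezout inverts it modulo [mu]. *)
Lemma Kring_Kfield : Kring iota chi = Kfield iota chi.
Proof.
apply/seteqP; split=> y.
  by move=> [f _ <-]; exists f => //; exists 1; rewrite /= rmorph1 ?oner_neq0 ?divr1.
move=> [p _ [q /= evq_neq0 <-]].
(* The gcd divides [q], so it does not vanish at chi; hence its cofactor [w] in [mu] does, and
   minimality of [mu] forces the gcd to be constant. *)
have cop : coprimep mu q.
  have /dvdpP[w mu_eq] := dvdp_gcdl mu q.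
  have evg_neq0 : ev (gcdp mu q) != 0.
    have /dvdpP[v q_eq] := dvdp_gcdr mu q.
    by apply: contraNneq evq_neq0 => evg0; rewrite q_eq rmorphM /= evg0 mulr0.
  have w_neq0 : w != 0.
    by apply: contraNneq mu_neq0 => w0; rewrite mu_eq w0 mul0r.
  have evw0 : ev w = 0.
    apply/eqP; rewrite -(inj_eq (mulIf evg_neq0)) mul0r -rmorphM /=.
    by rewrite -mu_eq ev_mu.
  have := mu_min w_neq0 evw0.
  have g_neq0 : gcdp mu q != 0 by rewrite gcdp_eq0 negb_and mu_neq0.
  rewrite {1}mu_eq size_mul // coprimep_def.
  have : (0 < size (gcdp mu q))%N by rewrite size_poly_gt0.
  have : (0 < size w)%N by rewrite size_poly_gt0.
  case: (size w) => // a _; case: (size _) => // b _.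
  by rewrite addnS /= -[leqRHS]addn0 leq_add2l leqn0 => /eqP->.
have /Bezout_eq1_coprimepP[[u v] /= uv1] := cop.
exists (p * v) => //; rewrite rmorphM; congr (_ * _).
apply: (mulIf evq_neq0); rewrite mulVf // -rmorphM /=.
have := congr1 ev uv1.
by rewrite rmorphD rmorphM /= ev_mu mulr0 add0r rmorph1.
Qed.

End MinimalPolynomial.

(** With a basis of size m, the m + 1 powers of chi from 0 to m are dependent. *)
Lemma Kdim_Kring_annihilator n : Kdim iota (Kring iota chi) = Some n ->
  exists2 f, f != 0 & ev f = 0.
Proof.
rewrite /Kdim; case: pselect => // ex _; case: ex => m [e Be].
have powers (i : 'I_m.+1) : Kring iota chi (chi ^+ i).
  by exists 'X^i; rewrite ?evchiXn.
have [c c0 [i ci]] := is_basis_dependent Be powers (ltnSn m).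
exists (\poly_(k < m.+1) c (inord k)).
  apply: contraNneq ci => p0.
  by have := congr1 (coefp i) p0; rewrite /= coef_poly coef0 ltn_ord inord_val => ->.
by rewrite evchi_poly -[RHS]c0; apply: eq_bigr => j _; rewrite inord_val.
Qed.

(** Turns the bound on K(chi) into bounds on annihilators and on K[chi]. If chi is algebraic, both
    rings coincide and have dimension the degree of a least annihilator; otherwise K[chi] has
    infinite dimension. *)
Lemma Kdim_Kfield_le n : le_inf (Some n) (Kdim iota (Kfield iota chi)) ->
  (forall f : {poly K}, f != 0 -> (size f <= n)%N -> ev f != 0) /\
  (forall k, (k < n)%N -> lt_inf (Some k) (Kdim iota (Kring iota chi))).
Proof.
move=> le_n.
have [[f f_neq0 evf]|no_annihilator] := pselect (exists2 f, f != 0 & ev f = 0).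
  pose P k := `[< exists f, [/\ f != 0, ev f = 0 & size f = k] >].
  have exP : exists k, P k by exists (size f); apply/asboolP; exists f.
  case: (ex_minnP exP) => _ /asboolP[mu [mu_neq0 ev_mu <-]] min_mu.
  have mu_min g : g != 0 -> ev g = 0 -> (size mu <= size g)%N.
    by move=> g0 evg; apply: min_mu; apply/asboolP; exists g.
  have dimE := Kdim_is_basis (is_basis_powers mu_neq0 ev_mu mu_min).
  move: le_n; rewrite -(Kring_Kfield mu_neq0 ev_mu mu_min) dimE /= leEnat => le_n.
  split=> [g g_neq0 le_g|k lt_k].
    apply/eqP => /(mu_min _ g_neq0) le_mu.
    have := leq_trans le_mu (leq_trans le_g le_n).
    by rewrite -ltnS prednK ?ltnn // size_poly_gt0.
  have lt_k' := leq_trans lt_k le_n.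
  rewrite /lt_inf /= leEnat ltnW // andbT; apply/eqP => -[eq_k].
  by rewrite eq_k ltnn in lt_k'.
split=> [g g_neq0 _|k _].
  by apply/eqP => evg; apply: no_annihilator; exists g.
case dimE: (Kdim _ _) => [m|//].
by case: no_annihilator; apply: Kdim_Kring_annihilator dimE.
Qed.

End Dimension.

(** * The order on values with infinity, and subgroups of values *)

Section OrderInf.
Context (G : porderZmodType) (hG : linearly_ordered_group G).
Implicit Types a b c : option G.

Lemma le_inf_total a b : le_inf a b || le_inf b a.
Proof. by case: a b => [x|] [y|] //=; case: hG => tot _; apply: tot. Qed.

Lemma le_inf_anti a b : le_inf a b -> le_inf b a -> a = b.
Proof.
by case: a b => [x|] [y|] //= le_xy le_yx; rewrite (@le_anti _ _ x y) ?le_xy.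
Qed.

Lemma lt_inf_neqP a b : a <> b -> lt_inf a b \/ lt_inf b a.
Proof.
move=> /eqP neq_ab; rewrite /lt_inf (eq_sym b) neq_ab.
by case/orP: (le_inf_total a b); [left|right].
Qed.

Lemma lt_infNge a b : lt_inf a b -> ~~ le_inf b a.
Proof.
by move=> /andP[/eqP neq_ab le_ab]; apply/negP => /(le_inf_anti le_ab).
Qed.

End OrderInf.

Lemma is_groupP (G : zmodType) (A : set (option G)) :
  is_group A <->
  [/\ ~ A None, A (Some 0) &
      forall x y, A (Some x) -> A (Some y) -> A (Some (x - y))].
Proof.
split=> [[A0 [A1 A2]]|[A0 A1 A2]].
  split=> //; first by move: A1; rewrite inE.
  by move=> x y Ax Ay; have := A2 x y; rewrite !inE; apply.
split=> //; split; first by rewrite inE.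
by move=> x y; rewrite !inE; apply: A2.
Qed.

(** * Elementary properties of module valuations *)

Section ModuleValuation.
Context (K L : fieldType) (iota : {rmorphism K -> L}) (chi : L).
Context (G : porderZmodType) (hG : linearly_ordered_group G).
Context (nu : L -> option G) (hmod : module_valuation iota chi nu).
Local Notation v f := (nu (evchi iota chi f)).

Lemma evchi_Kring f : Kring iota chi (evchi iota chi f).
Proof. by exists f. Qed.

Lemma module_valuation_None f : v f = None <-> evchi iota chi f = 0.
Proof. by case: hmod => nu0 _ _; apply/nu0/evchi_Kring. Qed.

Lemma module_valuationD f g : le_inf (min_inf (v f) (v g)) (v (f + g)).
Proof.
by case: hmod => _ nuD _; rewrite rmorphD; apply: nuD; apply: evchi_Kring.
Qed.

Lemma module_valuationZ c f : v (c *: f) = add_inf (v c%:P) (v f).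
Proof.
case: hmod => _ _ nuM; rewrite -mul_polyC rmorphM /= nuM //; last exact: evchi_Kring.
by exists c => //; rewrite evchiC.
Qed.

Lemma module_valuation1 : v 1 = Some 0.
Proof.
have := module_valuationZ 1 1; rewrite scale1r.
case v1: (v 1) => [x|].
  by move=> [/(congr1 (fun y => y - x))]; rewrite subrr addrK => <-.
by move/module_valuation_None: v1 => /eqP; rewrite rmorph1 oner_eq0.
Qed.

(** Adding x to a comparison of x with 0 gives the reverse comparison. This serves to show that -1
    has value 0. *)
Lemma ordered_group_double0 (x : G) : x + x = 0 -> x = 0.
Proof.
case: hG => tot mono xx0; apply: le_anti.
have := tot x 0; case/orP => [le_x0|le_0x].
  by have := mono _ _ x le_x0; rewrite xx0 add0r => ->; rewrite le_x0.
by have := mono _ _ x le_0x; rewrite xx0 add0r => ->; rewrite le_0x.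
Qed.

Lemma module_valuationN f : v (- f) = v f.
Proof.
have vN1 : v (-1)%:P = Some 0.
  have := module_valuationZ (-1) (-1)%:P; rewrite -mul_polyC -polyCM mulrNN mulr1.
  by rewrite module_valuation1; case: (v _) => //= x [/esym/ordered_group_double0->].
by rewrite -scaleN1r module_valuationZ vN1; case: (v f) => //= x; rewrite add0r.
Qed.

(** Writing [f] as [(f + g) - g] bounds [v f] below by the minimum of [v (f + g)] and [v g], and
    [v g] is too large to be that minimum. *)
Lemma module_valuationD_lt f g : lt_inf (v f) (v g) -> v (f + g) = v f.
Proof.
move=> lt_fg; apply: le_inf_anti; last first.
  have := module_valuationD f g; rewrite /min_inf.
  by move: lt_fg => /andP[_ ->].
have := module_valuationD (f + g) (- g); rewrite addrK module_valuationN /min_inf.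
by case: ifP => // _ /(negP (lt_infNge lt_fg)).
Qed.

Lemma valset_KpolyP m a : valset nu (Kpoly iota chi m) a <->
  a <> None /\ exists2 f : {poly K}, (size f <= m.+1)%N & v f = a.
Proof.
split=> [[[_ [f le_f <-] <-] /= neqN]|[neqN [f le_f vf]]].
  by split=> //; exists f.
by split=> //; exists (evchi iota chi f) => //; exists f.
Qed.

Lemma monic_valuesP d a : (0 < d)%N -> monic_values iota chi nu d a <->
  a <> None /\ exists2 Phi : {poly K}, monic_of_degree d Phi & v Phi = a.
Proof.
(* For [d] positive, [Kpoly d.-1] consists of the polynomials of size at most [d]. *)
case: d => // d _.
split=> [[[_ [_ [f /= le_f <-] <-] <-] neqN]|[neqN [Phi [monPhi sizePhi] vPhi]]].
  split=> //; exists ('X^(d.+1) - f); last by rewrite rmorphB /= evchiXn.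
  have lt_size : (size (- f)%R < size ('X^(d.+1) : {poly K})%R)%N.
    by rewrite size_polyN size_polyXn.
  split; last by rewrite size_polyDl // size_polyXn.
  by rewrite monicE lead_coefDl // lead_coefXn.
split=> //; exists (evchi iota chi Phi) => //.
exists (evchi iota chi ('X^(d.+1) - Phi)).
  2: by rewrite rmorphB /= evchiXn opprB addrC subrK.
exists ('X^(d.+1) - Phi) => //=.
apply/leq_sizeP => j le_j; rewrite coefB coefXn.
move: le_j; rewrite leq_eqVlt => /orP[/eqP<-|lt_j].
  by move: monPhi; rewrite monicE lead_coefE sizePhi /= => /eqP->; rewrite eqxx subrr.
by rewrite gtn_eqF // nth_default ?subrr // sizePhi.
Qed.

(** * Key polynomials of degree [d] under the bound [2 * d] *)

Section KeyDegree.
Variable d : nat.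
Hypothesis d_gt0 : (0 < d)%N.
Hypothesis nuM : forall f g : {poly K}, ((size f).-1 + (size g).-1 < 2 * d)%N ->
  v (f * g) = add_inf (v f) (v g).
Hypothesis ev_neq0 : forall f : {poly K}, f != 0 -> (size f <= 2 * d)%N ->
  evchi iota chi f != 0.
Hypothesis dimK : forall k, (k < 2 * d)%N -> lt_inf (Some k) (Kdim iota (Kring iota chi)).
Local Notation A := (valset nu (Kpoly iota chi d.-1)).

(** The asymmetry lets the second factor be a polynomial of degree exactly [d], such as Phi. *)
Lemma low_degree_sum m n : (m <= d)%N -> (n <= d.+1)%N -> (m.-1 + n.-1 < 2 * d)%N.
Proof. by move=> le_m le_n; lia. Qed.

Lemma low_degree_dim m n : (m <= d)%N -> (n <= d)%N ->
  lt_inf (Some (m.-1 + n.-1)%N) (Kdim iota (Kring iota chi)).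
Proof. by move=> le_m le_n; apply/dimK/low_degree_sum/leqW. Qed.

Lemma valset_Kpoly_predP a : A a <->
  a <> None /\ exists2 f : {poly K}, (size f <= d)%N & v f = a.
Proof. by rewrite valset_KpolyP prednK. Qed.

Lemma valuation_neqN (f : {poly K}) : f != 0 -> (size f <= 2 * d)%N -> v f <> None.
Proof. by move=> f_neq0 le_f /module_valuation_None/eqP; apply/negP/ev_neq0. Qed.

Lemma low_degree_valuation (f : {poly K}) : f != 0 -> (size f <= d)%N -> A (v f).
Proof.
move=> f_neq0 le_f; apply/valset_Kpoly_predP; split; last by exists f.
by apply: valuation_neqN => //; rewrite (leq_trans le_f) ?leq_pmull.
Qed.

Lemma low_degree_valuationM (f g : {poly K}) : (size f <= d)%N -> (size g <= d.+1)%N ->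
  v (f * g) = add_inf (v f) (v g).
Proof. by move=> le_f le_g; apply/nuM/low_degree_sum. Qed.

Lemma monic_of_degree_neqN Phi : monic_of_degree d Phi -> v Phi <> None.
Proof.
move=> [/monic_neq0 Phi_neq0 sizePhi]; apply: valuation_neqN => //.
by rewrite sizePhi mul2n -addnn -addn1 leq_add2l.
Qed.

Lemma monic_of_degree_valued Phi :
  monic_of_degree d Phi -> monic_values iota chi nu d (v Phi).
Proof.
move=> monPhi; apply/monic_valuesP => //; split; last by exists Phi.
exact: monic_of_degree_neqN.
Qed.

(* If another monic polynomial had a larger value, its difference with Phi,
   of degree less than d, would have the value of Phi. *)
Lemma monic_values_is_max Phi : monic_of_degree d Phi -> ~ A (v Phi) ->
  is_max (monic_values iota chi nu d) (v Phi).
Proof.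
move=> [monPhi sizePhi] notA; split; first exact: monic_of_degree_valued.
move=> _ /(monic_valuesP _ d_gt0)[_ [Psi [monPsi sizePsi] <-]].
apply: contra_notT notA => nle.
have lt_v : lt_inf (v Phi) (v Psi).
  rewrite /lt_inf; case/orP: (le_inf_total hG (v Psi) (v Phi)) => [le|->].
    by rewrite le in nle.
  rewrite andbT; apply: contraNneq nle => ->.
  by case: (v Psi) => //= x.
apply/valset_Kpoly_predP; split; first exact: monic_of_degree_neqN.
exists (Phi - Psi); last by apply: module_valuationD_lt; rewrite module_valuationN.
have le_size : (size (Phi - Psi)%R <= d.+1)%N.
  by rewrite (leq_trans (size_polyD _ _)) // size_polyN sizePhi sizePsi maxnn.
apply/leq_sizeP => j; rewrite leq_eqVlt => /orP[/eqP<-|lt_j].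
  have/eqP := monPhi; have/eqP := monPsi.
  by rewrite !lead_coefE sizePhi sizePsi coefB /= => -> ->; rewrite subrr.
by rewrite nth_default // (leq_trans le_size).
Qed.

(* A common factor of f and a key polynomial Phi would give a nonzero g of
   degree less than d with Phi | f g, against the value of the remainder of
   f g being finite.  So f is invertible modulo Phi. *)
Lemma key_polynomial_inverse (Phi f : {poly K}) : key_polynomial iota chi nu d Phi ->
  f != 0 -> (size f <= d)%N ->
  exists2 g : {poly K}, (size g <= d)%N & add_inf (v f) (v g) = Some 0.
Proof.
move=> [[monPhi sizePhi] _ _ keyPhi] f_neq0 le_f.
have Phi_neq0 := monic_neq0 monPhi.
have cop : coprimep f Phi.
  have /dvdpP[w Phi_eq] := dvdp_gcdr f Phi.
  have /dvdpP[u f_eq] := dvdp_gcdl f Phi.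
  have w_neq0 : w != 0 by apply: contraNneq Phi_neq0 => w0; rewrite Phi_eq w0 mul0r.
  have c_neq0 : gcdp f Phi != 0 by rewrite gcdp_eq0 negb_and f_neq0.
  rewrite coprimep_def; apply: contraT => size_neq1.
  have size_eq := size_mul w_neq0 c_neq0; rewrite -Phi_eq sizePhi in size_eq.
  have w_gt0 : (0 < size w)%N by rewrite size_poly_gt0.
  have c_gt0 : (0 < size (gcdp f Phi))%N by rewrite size_poly_gt0.
  have le_w : (size w <= d)%N.
    move: size_neq1 size_eq w_gt0 c_gt0.
    by move: (size w) (size (gcdp f Phi)) => a b; lia.
  have [|_] := keyPhi f w f_neq0 w_neq0 le_f le_w; first exact: low_degree_dim.
  have -> : (f * w) %% Phi = 0.
    by apply/modp_eq0P; rewrite {1}f_eq mulrAC -mulrA -Phi_eq dvdp_mull.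
  have -> : v 0 = None by apply/module_valuation_None; rewrite rmorph0.
  by rewrite /lt_inf; case: (nu _).
have /Bezout_eq1_coprimepP[[u w] /= uw1] := cop.
(* The Bezout coefficient of [f] is reduced modulo Phi to bring its degree below [d]; the product
   with [f] then has remainder 1, hence value 0. *)
have le_g : (size (u %% Phi)%R <= d)%N by rewrite -ltnS -sizePhi ltn_modp.
have fg1 : (f * (u %% Phi)) %% Phi = 1.
  rewrite modp_mul mulrC.
  have -> : u * f = 1 + (- w) * Phi by rewrite -uw1 mulNr addrK.
  rewrite modpD modp_mull addr0 modp_small // size_poly1 sizePhi; lia.
exists (u %% Phi) => //.
have g_neq0 : u %% Phi != 0.
  by apply: contra_eq_neq fg1 => ->; rewrite mulr0 mod0p eq_sym oner_neq0.
rewrite -low_degree_valuationM ?(leqW le_g) // rmorphM.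
have [|->] := keyPhi f _ f_neq0 g_neq0 le_f le_g; first exact: low_degree_dim.
by rewrite fg1 module_valuation1.
Qed.

(** If [h] has value opposite to that of [g], then x - y is the value of [f * h], hence of its
    remainder modulo Phi, which has degree less than [d]. *)
Lemma key_polynomial_is_group Phi : key_polynomial iota chi nu d Phi -> is_group A.
Proof.
move=> keyPhi; apply/is_groupP; split; first by move/valset_Kpoly_predP => [].
  rewrite -module_valuation1; apply: low_degree_valuation; rewrite ?oner_neq0 //.
  by rewrite size_poly1.
move=> x y /valset_Kpoly_predP[_ [f le_f vf]] /valset_Kpoly_predP[_ [g le_g vg]].
have poly_neq0 h z : v h = Some z -> h != 0.
  have v0 : v 0 = None by apply/module_valuation_None; rewrite rmorph0.
  by move=> vh; apply/eqP => h0; rewrite h0 v0 in vh.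
have [h le_h] := key_polynomial_inverse keyPhi (poly_neq0 _ _ vg) le_g.
rewrite vg; case vh: (v h) => [z|//] [yz0].
have -> : x - y = x + z by congr (_ + _); apply/eqP; rewrite eq_sym -addr_eq0 addrC yz0.
case: (keyPhi) => [[monPhi sizePhi] _ _ red].
have [|nu_eq] := red f h (poly_neq0 _ _ vf) (poly_neq0 _ _ vh) le_f le_h.
  exact: low_degree_dim.
rewrite -rmorphM low_degree_valuationM ?(leqW le_h) // vf vh /= in nu_eq *.
move=> _; apply/valset_Kpoly_predP; split=> //; exists ((f * h) %% Phi) => //.
by rewrite -ltnS -sizePhi ltn_modp monic_neq0.
Qed.

Lemma key_polynomial_of_value Phi : is_group A -> monic_of_degree d Phi ->
  ~ A (v Phi) -> key_polynomial iota chi nu d Phi.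
Proof.
move=> /is_groupP[_ A0 AB] degPhi notA; case: (degPhi) => monPhi sizePhi.
have Phi_neq0 := monic_neq0 monPhi.
have AD x y : A (Some x) -> A (Some y) -> A (Some (x + y)).
  by move=> Ax Ay; rewrite -[y]opprK; apply: (AB) => //; rewrite -sub0r; apply: AB.
split=> //; first by apply: dimK; lia.
move=> f g f_neq0 g_neq0 le_f le_g _.
have Afg : A (v (f * g)).
  rewrite low_degree_valuationM ?(leqW le_g) //.
  have := low_degree_valuation f_neq0 le_f; have := low_degree_valuation g_neq0 le_g.
  case vf: (v f) => [x|]; last by move=> _ /valset_Kpoly_predP[].
  case vg: (v g) => [y|]; last by move=> /valset_Kpoly_predP[].
  by move=> Ay Ax; apply: AD.
have fg_eq := divp_eq (f * g) Phi.
set q := _ %/ _ in fg_eq *; set r := _ %% _ in fg_eq *.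
have le_r : (size r <= d)%N by rewrite -ltnS -sizePhi ltn_modp.
(* This keeps [q * Phi] within the range where [v] is multiplicative. *)
have le_q : (size q <= d)%N.
  rewrite /q size_divp // sizePhi leq_subLR (leq_trans (size_polyMleq _ _)) //.
  by rewrite (leq_trans (leq_pred _)) // leq_add.
rewrite -!rmorphM.
(* Were [v q + v Phi] in the group [A], subtracting [v q] would put [v Phi] there. For [q = 0] the
   value is infinite, hence outside [A]. *)
have notAq : ~ A (v (q * Phi)).
  rewrite low_degree_valuationM ?sizePhi //.
  have [->|q_neq0] := eqVneq q 0.
    rewrite (iffRL (module_valuation_None 0) (rmorph0 _)).
    by move/valset_Kpoly_predP => [].
  have := low_degree_valuation q_neq0 le_q.
  case vPhi: (v Phi) notA => [z|] notA; last first.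
    by case: (v q) => [x|] _ /valset_Kpoly_predP[].
  case: (v q) => [x|] /= Ax Axz; last by case/valset_Kpoly_predP: Ax.
  apply: notA.
  by rewrite -[z](addKr x) addrC; apply: AB.
(* A nonzero [r] has value in [A]; if [r = 0], then [q * Phi] is [f * g], whose value is in [A].
   Either way equality contradicts [notAq]. *)
have neq_v : v r <> v (q * Phi).
  move=> eq_v; have [r0|r_neq0] := eqVneq r 0; last first.
    by apply: notAq; rewrite -eq_v; apply: low_degree_valuation.
  by apply: notAq; rewrite -[q * Phi]addr0 -{1}r0 -fg_eq.
have [lt_r|lt_q] := lt_inf_neqP hG neq_v.
  by split=> //; rewrite fg_eq addrC module_valuationD_lt.
(* If [q * Phi] had the smaller value, [f * g] would share it, against [Afg]. *)
by case: notAq; rewrite -(module_valuationD_lt lt_q) -fg_eq.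
Qed.

(** A polynomial of degree [d] is its leading coefficient times a monic one. Constants have values
    in [A], so if all monic values were in [A], the group law would bring in no new value in degree
    [d]. *)
Lemma exists_monic_value_notin :
  is_group A -> valset nu (Kpoly iota chi d) <> A ->
  exists2 Phi : {poly K}, monic_of_degree d Phi & ~ A (v Phi).
Proof.
move=> /is_groupP[_ A0 AB] neqA; apply: contra_notP neqA => no_Phi.
apply/seteqP; split=> a; last first.
  move=> /valset_Kpoly_predP[neqN [f le_f vf]]; apply/valset_KpolyP; split=> //.
  by exists f => //; apply: leqW.
move=> /valset_KpolyP[neqN [f le_f vf]].
move: le_f; rewrite leq_eqVlt ltnS => /orP[/eqP size_f|le_f]; last first.
  by apply/valset_Kpoly_predP; split=> //; exists f.
have f_neq0 : f != 0 by rewrite -size_poly_gt0 size_f.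
set c := lead_coef f; have c_neq0 : c != 0 by rewrite lead_coef_eq0.
have Ac : A (v c%:P).
  apply: low_degree_valuation; rewrite ?polyC_eq0 //.
  by rewrite (leq_trans (size_polyC_leq1 _)).
have APhi : A (v (c^-1 *: f)).
  apply: contra_notP no_Phi => notA; exists (c^-1 *: f) => //.
  split; last by rewrite size_scale ?invr_eq0.
  by rewrite monicE lead_coefZ mulVf.
move: APhi Ac; rewrite -vf -[in X in _ -> _ -> X](scale1r f) -(mulfV c_neq0) -scalerA.
rewrite (module_valuationZ c).
case: (v c%:P) => [x|]; last by move=> _ /valset_Kpoly_predP[].
case: (v _) => [y|] Ay Ax /=; last by move/valset_Kpoly_predP: Ay => [].
by rewrite -[y]opprK; apply: (AB) => //; rewrite -sub0r; apply: AB.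
Qed.

(** The maximum [m], being the value of a monic polynomial of degree [d], is itself the value that
    distinguishes the two sets. *)
Lemma valuational_key_degree_is_group : valuational_key_degree iota chi nu d ->
  is_group A /\ valset nu (Kpoly iota chi d) <> A.
Proof.
move=> [[Phi keyPhi] [m [/(monic_valuesP _ d_gt0)[neqN [Psi [_ sizePsi] vPsi]] _]] notA].
split; first exact: key_polynomial_is_group keyPhi.
move=> eqA; apply: notA; rewrite -eqA; apply/valset_KpolyP.
by split=> //; exists Psi; rewrite ?sizePsi.
Qed.

End KeyDegree.
End ModuleValuation.

(** * Valuational key degrees characterised by their value sets *)

Theorem proposition4p3 (K L : fieldType) (iota : {rmorphism K -> L}) (chi : L)
    (G : porderZmodType) (nu : L -> option G) (d : nat)
    (hG : linearly_ordered_group G)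
    (hchi : ~ baseK iota chi)
    (hnu : pm_valuation iota chi nu)
    (hrank : finite_rank (valset nu (baseK iota)))
    (hd1 : (1 <= d)%N)
    (hd2 : le_inf (Some (2 * d)%N) (Kdim iota (Kfield iota chi))) :
  (valuational_key_degree iota chi nu d <->
     is_group (valset nu (Kpoly iota chi d.-1)) /\
     valset nu (Kpoly iota chi d) <> valset nu (Kpoly iota chi d.-1)) /\
  (valuational_key_degree iota chi nu d ->
     forall Phi : {poly K}, monic_of_degree d Phi ->
       (is_max (monic_values iota chi nu d) (nu (evchi iota chi Phi)) <->
          ~ valset nu (Kpoly iota chi d.-1) (nu (evchi iota chi Phi))) /\
       (is_max (monic_values iota chi nu d) (nu (evchi iota chi Phi)) ->
          key_polynomial iota chi nu d Phi)).
Proof.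
have [hmod hmul _] := hnu.
have [ev_neq0 dimK] := Kdim_Kfield_le hd2.
have nuM (f g : {poly K}) : ((size f).-1 + (size g).-1 < 2 * d)%N ->
    nu (evchi iota chi (f * g)) = add_inf (nu (evchi iota chi f)) (nu (evchi iota chi g)).
  by move=> lt_d; rewrite rmorphM; apply/hmul/dimK.
have keyP Phi : is_group (valset nu (Kpoly iota chi d.-1)) ->
    monic_of_degree d Phi -> ~ valset nu (Kpoly iota chi d.-1) (nu (evchi iota chi Phi)) ->
    key_polynomial iota chi nu d Phi.
  exact: key_polynomial_of_value.
split.
  split=> [|[grpA neqA]]; first exact: valuational_key_degree_is_group.
  have [Phi monPhi notA] := exists_monic_value_notin hmod hd1 ev_neq0 grpA neqA.
  split; first by exists Phi; apply: keyP.
  by exists (nu (evchi iota chi Phi)) => //; apply: monic_values_is_max.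
move=> vkd Phi monPhi.
have [grpA _] := valuational_key_degree_is_group hmod hd1 nuM ev_neq0 dimK vkd.
(* A maximum is unique by antisymmetry, so [nu] of Phi is the maximum outside [A] supplied by
   [vkd]. *)
have max_notA : is_max (monic_values iota chi nu d) (nu (evchi iota chi Phi)) ->
    ~ valset nu (Kpoly iota chi d.-1) (nu (evchi iota chi Phi)).
  case: vkd => _ [m [monm maxm] notA] [monv maxv].
  by rewrite (le_inf_anti (maxm _ monv) (maxv _ monm)).
split; last by move=> /max_notA; apply: keyP.
by split=> // notA; apply: monic_values_is_max.
Qed.
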